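(* Let $\Gamma$ be a discrete group with Kazhdan's Property (T). Then $\Gamma$ has an essentially free amenable action on some set if and only if $\Gamma$ is residually finite.
   Context: An action of $\Gamma$ on a set $X$ is an essentially free amenable action if there exists a $\Gamma$-invariant finitely additive probability measure $\mu$ defined on all subsets of $X$ such that for every $1\ne g\in\Gamma$ the fixed point set $\mathrm{Fix}(g)\subseteq X$ satisfies $\mu(\mathrm{Fix}(g))=0$. *)

(* Defs.v *)
From HB Require Import structures.
From mathcomp Require Import all_boot all_order all_algebra all_fingroup.
From mathcomp Require Import complex.
From mathcomp Require Import all_classical all_reals all_analysis.

Set Implicit Arguments.
Unset Strict Implicit.
Unset Printing Implicit Defensive.

Import Order.TTheory GRing.Theory Num.Theory.
Import numFieldNormedType.Exports.

Local Open Scope classical_set_scope.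
Local Open Scope complex_scope.
Local Open Scope ring_scope.

(* Groups are discrete: a [groupType] carries no topology, so every
   homomorphism to a unitary group is continuous and the compact subsets of the
   group are its finite subsets. *)

(* A complex Hilbert space is a complete normed module over [R[i]] together
   with an inner product (linear in its first argument) inducing its norm. *)
Definition is_hilbert (R : realType) (H : completeNormedModType R[i])
    (ip : {dot H for Num.conj}) : Prop :=
  forall v : H, `|v| ^+ 2 = ip v v.

(* Each [U g] is surjective, hence unitary, because [U g^-1] is its inverse. *)
Record is_unitary_representation (R : realType) (G : groupType)
    (H : completeNormedModType R[i]) (ip : {dot H for Num.conj})
    (U : G -> {linear H -> H}) : Prop := IsUnitaryRepresentation {
  unitary_rep1 : forall v, U 1%g v = v ;
  unitary_repM : forall g h v, U (g * h)%g v = U g (U h v) ;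
  unitary_rep_isometry : forall g, isometry ip ip (U g)
}.

Definition has_almost_invariant_vector (R : realType) (G : groupType)
    (H : completeNormedModType R[i]) (U : G -> {linear H -> H})
    (K : set G) (e : R) : Prop :=
  exists2 v : H, v != 0 & forall g, K g -> `|U g v - v| < e%:C * `|v|.

Definition has_invariant_vector (R : realType) (G : groupType)
    (H : completeNormedModType R[i]) (U : G -> {linear H -> H}) : Prop :=
  exists2 v : H, v != 0 & forall g, U g v = v.

Definition kazhdan_property_T (R : realType) (G : groupType) : Prop :=
  exists (K : set G) (e : R), [/\ finite_set K, 0 < e &
    forall (H : completeNormedModType R[i]) (ip : {dot H for Num.conj})
      (U : G -> {linear H -> H}),
      is_hilbert ip -> is_unitary_representation ip U ->
      has_almost_invariant_vector U K e -> has_invariant_vector U].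

Record is_group_action (G : groupType) (X : Type) (act : G -> X -> X) : Prop :=
  IsGroupAction {
    group_act1 : forall x, act 1%g x = x ;
    group_actM : forall g h x, act (g * h)%g x = act g (act h x)
  }.

Record is_finitely_additive_probability (R : realType) (X : Type)
    (mu : set X -> R) : Prop := IsFinitelyAdditiveProbability {
  fap_ge0 : forall A, 0 <= mu A ;
  fap_setT : mu setT = 1 ;
  fap_setU : forall A B, A `&` B = set0 -> mu (A `|` B) = mu A + mu B
}.

Definition invariant_under (R : realType) (G : groupType) (X : Type)
    (act : G -> X -> X) (mu : set X -> R) : Prop :=
  forall g A, mu (act g @` A) = mu A.

Definition fixed_points (G : groupType) (X : Type) (act : G -> X -> X) (g : G)
  : set X := [set x | act g x = x].

Definition essentially_free_amenable (R : realType) (G : groupType) (X : Type)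
    (act : G -> X -> X) : Prop :=
  exists mu : set X -> R, [/\ is_finitely_additive_probability mu,
    invariant_under act mu &
    forall g : G, g <> 1%g -> mu (fixed_points act g) = 0].

Definition residually_finite (G : groupType) : Prop :=
  forall g : G, g <> 1%g ->
    exists (F : finGroupType) (f : {multiplicative G -> F}), f g <> 1%g.

(* Main.v *)
(* If G is residually finite, it acts by translations on the disjoint union of
   finite groups F_S, one for each finite subset S of G, where G -> F_S kills
   no nontrivial element of S. An ultralimit of the normalized counting
   measures of the F_S is an invariant mean, and g has no fixed point in F_S as
   soon as g \in S.

   Conversely, if g <> 1 is trivial in all finite quotients, then g fixes every
   point with a finite orbit, so the mean lives on the set X of points with
   infinite orbits. The representation on l2(X) has no invariant vector, hence
   by property (T) the operator A = \sum_(g in L) g, for a suitable finite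
   symmetric L containing 1, has norm smaller than t for some t < |L|. On each
   L-connected component, the Green function u = \sum_n t^-n A^n delta_x0 is
   positive and satisfies A u <= t u. Put r_g (x) = u(g^-1 x) / u(x); these
   functions are bounded and sum to at most t over L. The mean of r_(g^-1) is
   that of 1 / r_g by invariance, so L being symmetric, AM-GM shows that the
   mean of \sum_(g in L) r_g is at least |L|: a contradiction. *)
Require Import Defs.
From HB Require Import structures.
From mathcomp Require Import all_boot all_order all_algebra all_fingroup finmap.
From mathcomp Require Import complex.
From mathcomp Require Import all_classical all_reals all_analysis.
From mathcomp Require Import summability.
From mathcomp Require Import ring lra.

Set Implicit Arguments.
Unset Strict Implicit.
Unset Printing Implicit Defensive.

Import Order.TTheory GRing.Theory Num.Theory.
Import numFieldNormedType.Exports.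

Local Open Scope classical_set_scope.
Local Open Scope complex_scope.
Local Open Scope ring_scope.

#[local] Existing Instance totally_filter.

(** * Unconditional sums *)

Section UnconditionalSums.
Variables (R : realType) (I : choiceType).
Implicit Types (a b : I -> R) (J : {fset I}).

Definition summable_fun a := exists M, forall J, \sum_(i <- J) `|a i| <= M.

(** The limit is taken along finite subsets ordered by inclusion. It is meaningful only for summable
    families, hence the summability hypotheses below. *)
Definition usum a : R := lim ((fun J => \sum_(i <- J) a i) @ totally).

Lemma ler_sum_fset a J0 J : (forall i, 0 <= a i) -> (J0 `<=` J)%fset ->
  \sum_(i <- J0) a i <= \sum_(i <- J) a i.
Proof.
move=> a0 sJ; rewrite [leRHS](big_fsetID _ (mem J0))/=.
have -> : [fset x in J | x \in J0]%fset = J0.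
  apply/fsetP => x; rewrite !inE /=; case xJ0: (x \in J0); rewrite ?andbF ?andbT//.
  exact: (fsubsetP sJ).
by rewrite lerDl sumr_ge0.
Qed.

Lemma near_totally (P : {fset I} -> Prop) J0 :
  (forall J, (J0 `<=` J)%fset -> P J) -> \forall J \near totally, P J.
Proof. by move=> JP; exists J0. Qed.

Lemma summable_funD a b :
  summable_fun a -> summable_fun b -> summable_fun (fun i => a i + b i).
Proof.
move=> [M aM] [N bN]; exists (M + N) => J.
apply: le_trans (lerD (aM J) (bN J)); rewrite -big_split/=.
by apply: ler_sum => i _; exact: ler_normD.
Qed.

Lemma summable_funZ k a : summable_fun a -> summable_fun (fun i => k * a i).
Proof.
move=> [M aM]; exists (`|k| * M) => J.
apply: le_trans (ler_wpM2l (normr_ge0 k) (aM J)); rewrite mulr_sumr.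
by apply: ler_sum => i _; rewrite normrM.
Qed.

Lemma summable_fun_le a b : (forall i, `|a i| <= b i) -> summable_fun b ->
  summable_fun a.
Proof.
move=> ab [M bM]; exists M => J; apply: le_trans (bM J).
by apply: ler_sum => i _; exact: le_trans (ab i) (ler_norm _).
Qed.

Lemma usum_cvg_ge0 a : (forall i, 0 <= a i) -> summable_fun a ->
  (fun J => \sum_(i <- J) a i) @ totally -->
  sup (range (fun J => \sum_(i <- J) a i)).
Proof.
move=> a0 [M aM]; set A := (X in sup X).
have Asup : has_sup A.
  split; first by exists (\sum_(i <- fset0) a i), fset0.
  exists M => _ [J _ <-]; apply: le_trans (aM J).
  by apply: ler_sum => i _; exact: ler_norm.
apply/cvgrPdist_le => e e0.
have [_ [J0 _ <-] J0e] := sup_adherent e0 Asup.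
apply: (@near_totally _ J0) => J J0J.
have JA : A (\sum_(i <- J) a i) by exists J.
have := ub_le_sup Asup.2 JA; have := ler_sum_fset a0 J0J.
by move=> ? ?; rewrite ger0_norm; lra.
Qed.

Lemma usum_cvg a : summable_fun a ->
  (fun J => \sum_(i <- J) a i) @ totally --> usum a.
Proof.
move=> sa; apply/cvg_ex.
have sn : summable_fun (fun i => `|a i|).
  by have [M aM] := sa; exists M => J; under eq_bigr do rewrite normr_id.

(* Writing [a] as [(|a| + a) - |a|] reduces to the monotone case of nonnegative families. *)
have sp : summable_fun (fun i => `|a i| + a i) by exact: summable_funD.
have p0 i : 0 <= `|a i| + a i by have := ler_norm (- a i); rewrite normrN; lra.
eexists.
have -> : (fun J => \sum_(i <- J) a i) =
    (fun J => \sum_(i <- J) (`|a i| + a i) - \sum_(i <- J) `|a i|).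
  by apply/funext => J; rewrite big_split/= addrAC subrr add0r.
by apply: cvgB; apply: usum_cvg_ge0.
Qed.

Lemma usumD a b : summable_fun a -> summable_fun b ->
  usum (fun i => a i + b i) = usum a + usum b.
Proof.
move=> sa sb; apply: cvg_lim => //.
under eq_fun do rewrite big_split/=.
by apply: cvgD; exact: usum_cvg.
Qed.

Lemma usumZ k a : summable_fun a -> usum (fun i => k * a i) = k * usum a.
Proof.
move=> sa; apply: cvg_lim => //.
under eq_fun do rewrite -mulr_sumr.
by apply: cvgMr; exact: usum_cvg.
Qed.

Lemma eq_usum a b : a =1 b -> usum a = usum b.
Proof. by move=> /funext ->. Qed.

Lemma sum_le_usum a J : (forall i, 0 <= a i) -> summable_fun a ->
  \sum_(i <- J) a i <= usum a.
Proof.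
move=> a0 sa; apply: limr_ge; first exact: cvgP (usum_cvg sa).
by exists J => // J' JJ'; exact: ler_sum_fset.
Qed.

Lemma usum_le a M : summable_fun a -> (forall J, \sum_(i <- J) a i <= M) ->
  usum a <= M.
Proof.
move=> sa aM; apply: limr_le; first exact: cvgP (usum_cvg sa).
by exists fset0.
Qed.

Lemma usum_ge0 a : (forall i, 0 <= a i) -> summable_fun a -> 0 <= usum a.
Proof.
by move=> a0 sa; have := sum_le_usum fset0 a0 sa; rewrite big_seq_fset0.
Qed.

(** A bijection permutes the finite subsets of [I] cofinally, so both nets of partial sums have the
    same limit. Unitarity of the shift rests on this. *)
Lemma usum_reindex a (f g : I -> I) : cancel f g -> cancel g f ->
  summable_fun a -> summable_fun (a \o f) /\ usum (a \o f) = usum a.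
Proof.
move=> fK gK.
have fsumE b J : \sum_(i <- J) b (f i) = \sum_(i <- (f @` J)%fset) b i.
  by rewrite big_imfset//= => x y _ _ /(can_inj fK).
have fsummable b : summable_fun b -> summable_fun (b \o f).
  by move=> [M bM]; exists M => J; rewrite (fsumE (fun i => `|b i|)).
move=> sa; split; first exact: fsummable.
apply: cvg_lim => //; apply/cvgrPdist_le => e e0.
have /cvgrPdist_le/(_ e e0)[J0 _ J0e] := usum_cvg sa.
apply: (@near_totally _ (g @` J0)%fset) => J J0J; rewrite /= fsumE.
apply: J0e => /=; apply/fsubsetP => x xJ0; apply/imfsetP.
exists (g x) => //; apply: (fsubsetP J0J).
by rewrite in_imfset.
Qed.

End UnconditionalSums.

(** * The Hilbert space of square-summable functions *)

Section SquareSummable.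
Variables (R : realType) (I : choiceType).
Local Notation C := R[i].

Definition sqc (z : C) : R := complex.Re z ^+ 2 + complex.Im z ^+ 2.

Lemma sqc_ge0 z : 0 <= sqc z.
Proof. by rewrite addr_ge0 ?sqr_ge0. Qed.

Lemma sqcM z w : sqc (z * w) = sqc z * sqc w.
Proof. by case: z w => [a b] [c d]; rewrite /sqc /=; ring. Qed.

Lemma sqc_eq0 z : sqc z = 0 -> z = 0.
Proof.
case: z => a b; rewrite /sqc/= => /eqP; rewrite paddr_eq0 ?sqr_ge0//.
by rewrite !sqrf_eq0 => /andP[/eqP-> /eqP->].
Qed.

(** Young's inequality with a free weight. The weight [1] gives stability of square-summability
    under sums; an optimal weight gives the triangle inequality without Cauchy-Schwarz. *)
Lemma sqcD_le (t : R) z w : 0 < t ->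
  sqc (z + w) <= (1 + t) * sqc z + (1 + t^-1) * sqc w.
Proof.
move=> t0; case: z w => [a b] [c d]; rewrite /sqc /=.
have key (x y : R) : (x + y) ^+ 2 <= (1 + t) * x ^+ 2 + (1 + t^-1) * y ^+ 2.
  have -> : (1 + t) * x ^+ 2 + (1 + t^-1) * y ^+ 2 =
      (x + y) ^+ 2 + t^-1 * (t * x - y) ^+ 2 by field; rewrite gt_eqF.
  by rewrite lerDl mulr_ge0 ?sqr_ge0// invr_ge0 ltW.
by have := key a c; have := key b d; lra.
Qed.

Definition sq_summable : {pred I -> C} :=
  fun f => `[< summable_fun (fun i => sqc (f i)) >].

Lemma sq_summable_submod : submod_closed sq_summable.
Proof.
split=> [|k f g /asboolP sf /asboolP sg].
  apply/asboolP; exists 0 => J; rewrite big1// => i _.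
  by rewrite /sqc/= expr0n addr0 normr0.
apply/asboolP.
apply: (@summable_fun_le _ _ _
    (fun i => ((1 + 1) * sqc k) * sqc (f i) + (1 + 1^-1) * sqc (g i))) => [i|].
  rewrite ger0_norm ?sqc_ge0//; apply: le_trans (sqcD_le _ _ ltr01) _.
  by rewrite sqcM mulrA.
by apply: summable_funD; exact: summable_funZ.
Qed.

HB.instance Definition _ :=
  GRing.isSubmodClosed.Build C (I -> C) sq_summable sq_summable_submod.

Record l2 := L2 { l2fun :> I -> C ; l2P : l2fun \in sq_summable }.

HB.instance Definition _ := [isSub for l2fun].
HB.instance Definition _ := [Choice of l2 by <:].
HB.instance Definition _ := [SubChoice_isSubLmodule of l2 by <:].

Implicit Types u v w : l2.

Lemma l2_ext u v : (u : I -> C) =1 v -> u = v.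
Proof. by move=> uv; apply: val_inj; apply/funext. Qed.

Lemma l2D u v i : (u + v) i = u i + v i. Proof. by []. Qed.
Lemma l2B u v i : (u - v) i = u i - v i. Proof. by []. Qed.
Lemma l2Z k u i : (k *: u) i = k * u i. Proof. by []. Qed.

Definition l2sq u : R := usum (fun i => sqc (u i)).

Lemma l2_summable u : summable_fun (fun i => sqc (u i)).
Proof. exact/asboolP/l2P. Qed.

Lemma l2sq_ge0 u : 0 <= l2sq u.
Proof. by apply: usum_ge0 (l2_summable u) => i; exact: sqc_ge0. Qed.

Lemma sqc_le_l2sq u i : sqc (u i) <= l2sq u.
Proof.
have := sum_le_usum [fset i]%fset (fun i => sqc_ge0 (u i)) (l2_summable u).
by rewrite big_seq_fset1.
Qed.

Lemma l2sq_eq0 u : l2sq u = 0 -> u = 0.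
Proof.
move=> u0; apply: l2_ext => i; apply: sqc_eq0; apply/eqP.
by rewrite eq_le sqc_ge0 andbT -u0 sqc_le_l2sq.
Qed.

Lemma l2sqZ k u : l2sq (k *: u) = sqc k * l2sq u.
Proof.
rewrite /l2sq -(usumZ _ (l2_summable u)).
by apply: eq_usum => i; rewrite -sqcM.
Qed.

Lemma l2sqD_le (t : R) u v : 0 < t ->
  l2sq (u + v) <= (1 + t) * l2sq u + (1 + t^-1) * l2sq v.
Proof.
move=> t0; apply: usum_le; first exact: l2_summable.
move=> J; apply: (@le_trans _ _ ((1 + t) * (\sum_(i <- J) sqc (u i)) +
   (1 + t^-1) * \sum_(i <- J) sqc (v i))).
  rewrite !mulr_sumr -big_split/=; apply: ler_sum => i _; exact: sqcD_le.
apply: lerD; apply: ler_wpM2l.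
- by rewrite addr_ge0// ltW.
- by apply: sum_le_usum (l2_summable u) => i; exact: sqc_ge0.
- by rewrite addr_ge0// invr_ge0 ltW.
- by apply: sum_le_usum (l2_summable v) => i; exact: sqc_ge0.
Qed.

Definition l2norm u : C := (Num.sqrt (l2sq u))%:C.

Lemma l2norm_triangle u v : l2norm (u + v) <= l2norm u + l2norm v.
Proof.
have e0 w : Num.sqrt (l2sq w) = 0 -> w = 0.
  by move/eqP; rewrite sqrtr_eq0 => w0; apply: l2sq_eq0; apply/eqP;
     rewrite eq_le w0 l2sq_ge0.
rewrite /l2norm -rmorphD/= lecR.
have [/e0 ->|a0] := eqVneq (Num.sqrt (l2sq u)) 0.
  by rewrite add0r lerDr sqrtr_ge0.
have [/e0 ->|b0] := eqVneq (Num.sqrt (l2sq v)) 0.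
  by rewrite addr0 lerDl sqrtr_ge0.
set a := Num.sqrt (l2sq u) in a0 *; set b := Num.sqrt (l2sq v) in b0 *.
have {}a0 : 0 < a by rewrite lt_neqAle eq_sym a0 sqrtr_ge0.
have {}b0 : 0 < b by rewrite lt_neqAle eq_sym b0 sqrtr_ge0.
rewrite -[leRHS]ger0_norm -?sqrtr_sqr; last by rewrite addr_ge0 ?ltW.
rewrite ler_sqrt ?sqr_ge0//.
(* With [t = b / a] the right-hand side is exactly [(a + b) ^+ 2]; the cases where [a] or [b]
   vanishes were set aside for this division. *)
have := l2sqD_le u v (divr_gt0 b0 a0).
rewrite -(sqr_sqrtr (l2sq_ge0 u)) -(sqr_sqrtr (l2sq_ge0 v)) -/a -/b.
congr (_ <= _); field; by rewrite !gt_eqF.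
Qed.

Lemma l2normZ k u : l2norm (k *: u) = `|k| * l2norm u.
Proof.
by rewrite /l2norm l2sqZ sqrtrM ?sqc_ge0// normc_def -rmorphM.
Qed.

Lemma l2norm_eq0 u : l2norm u = 0 -> u = 0.
Proof.
case=> /eqP; rewrite sqrtr_eq0 => u0; apply: l2sq_eq0; apply/eqP.
by rewrite eq_le u0 l2sq_ge0.
Qed.

HB.instance Definition _ :=
  Lmodule_isNormed.Build C l2 l2norm_triangle l2normZ l2norm_eq0.

Lemma l2_normE u : `|u| = (Num.sqrt (l2sq u))%:C.
Proof. by []. Qed.

Lemma l2norm_lt (e : R) u : 0 < e -> (`|u| < e%:C) = (l2sq u < e ^+ 2).
Proof.
move=> e0; rewrite l2_normE ltcR -{1}[e]ger0_norm ?ltW// -sqrtr_sqr.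
by rewrite ltr_sqrt// exprn_gt0.
Qed.

Lemma l2norm_le (e : R) u : 0 <= e -> (`|u| <= e%:C) = (l2sq u <= e ^+ 2).
Proof.
move=> e0; rewrite l2_normE lecR -{1}[e]ger0_norm// -sqrtr_sqr.
by rewrite ler_sqrt// sqr_ge0.
Qed.

(** Coordinates are dominated by the norm, so they converge to some [w]. Bounds on finite partial
    sums pass to the limit, which puts [w] in l2 and gives convergence in norm. *)
Lemma l2_complete (F : set_system l2) : ProperFilter F -> cauchy F -> cvg F.
Proof.
move=> FF /cauchyP Fc.
have {}Fc (e : R) : 0 < e -> exists x : l2, F [set y | `|x - y| < e%:C].
  move=> e0; have [|x Fx] := Fc e%:C; first by rewrite ltcR.
  by exists x.
have coordP (p : C -> R) : (forall z w : C, p (z - w) = p z - p w) ->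
    (forall z, `|p z| ^+ 2 <= sqc z) ->
    forall i, cvg ((fun u : l2 => p (u i)) @ F).
  move=> pB ple i; apply: R_complete; apply/cauchyP => e e0.
  have [x Fx] := Fc e e0; exists (p (x i)).
  suff : F [set y : l2 | ball (p (x i)) e (p (y i))] by [].
  apply: filterS Fx => y xy.
  have {}xy : l2sq (x - y) < e ^+ 2 by rewrite -l2norm_lt.
  rewrite /mkset /ball/= -pB -ltr_sqr ?nnegrE ?normr_ge0 ?(ltW e0)//.
  by apply: le_lt_trans xy; apply: le_trans (ple _) (sqc_le_l2sq (x - y) i).
have cRe : forall i, cvg ((fun u : l2 => complex.Re (u i)) @ F).
  apply: (coordP (@complex.Re R)) => [[a b] [c d]|[a b]] //.
  by rewrite /sqc/= real_normK ?num_real// lerDl sqr_ge0.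
have cIm : forall i, cvg ((fun u : l2 => complex.Im (u i)) @ F).
  apply: (coordP (@complex.Im R)) => [[a b] [c d]|[a b]] //.
  by rewrite /sqc/= real_normK ?num_real// lerDr sqr_ge0.
pose w i : C := lim ((fun u : l2 => complex.Re (u i)) @ F) +i*
                lim ((fun u : l2 => complex.Im (u i)) @ F).
have sq_cvg (f : l2 -> R) (c l : R) : f @ F --> l ->
    (fun y => (c - f y) ^+ 2) @ F --> (c - l) ^+ 2.
  move=> fl; rewrite expr2; under eq_fun do rewrite expr2.
  by apply: cvgM; (apply: cvgB; [exact: cvg_cst|exact: fl]).
have near_w (e : R) (x : l2) : 0 < e -> F [set y | `|x - y| < e%:C] ->
    forall J : {fset I}, \sum_(i <- J) sqc (x i - w i) <= e ^+ 2.
  move=> e0 Fx J.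
  have cv : (fun y : l2 => \sum_(i <- J) sqc (x i - y i)) @ F -->
      \sum_(i <- J) sqc (x i - w i).
    apply: cvg_big; [exact: add_continuous|move=> i _].
    have subE (y : C) : sqc (x i - y) =
        (complex.Re (x i) - complex.Re y) ^+ 2 + (complex.Im (x i) - complex.Im y) ^+ 2.
      by case: (x i) y => [a b] [c d].
    under eq_fun do rewrite subE; rewrite subE.
    by apply: cvgD; apply: sq_cvg; [exact: cRe|exact: cIm].
  rewrite -(cvg_lim _ cv)//; apply: limr_le; first exact: cvgP cv.
  apply: filterS Fx => y xy.
  have : l2sq (x - y) < e ^+ 2 by rewrite -l2norm_lt.
  move/ltW; apply: le_trans.
  by apply: sum_le_usum (l2_summable (x - y)) => i; exact: sqc_ge0.
have ws : w \in sq_summable.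
  have [x Fx] := Fc 1 ltr01.
  have xw : (x : I -> C) - w \in sq_summable.
    apply/asboolP; exists (1 ^+ 2) => J; apply: le_trans (near_w 1 x ltr01 Fx J).
    by apply: ler_sum => i _; rewrite ger0_norm// sqc_ge0.
  have -> : w = (x : I -> C) - ((x : I -> C) - w) by rewrite subKr.
  by apply: rpredB => //; exact: l2P.
pose W : l2 := L2 ws.
apply/cvg_ex; exists W; apply/cvgrPdist_lt => e e0.
(* A positive element of [R[i]] is real, so [e] is split into two equal real halves. *)
have [r [r0 re]] : exists r : R, 0 < r /\ r%:C + r%:C = e.
  case: e e0 => a b; rewrite ltcE/= => /andP[/eqP-> a0].
  exists (a / 2); split; first by lra.
  by rewrite -rmorphD/= -splitr.
have [x Fx] := Fc r r0.
apply: filterS (Fx) => y xy; rewrite -(subrKA x) -re.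
apply: le_lt_trans (ler_normD _ _) _; apply: ler_ltD => //.
rewrite distrC (l2norm_le _ (ltW r0)); apply: usum_le; first exact: l2_summable.
exact: near_w.
Qed.

HB.instance Definition _ := Uniform_isComplete.Build l2 l2_complete.

(** By [2 |x y| <= x ^+ 2 + y ^+ 2]; this dominates the two real series that define the inner
    product. *)
Lemma Re_Im_mulJ_le (z w : C) :
  `|complex.Re (z * w^*)| <= sqc z + sqc w /\
  `|complex.Im (z * w^*)| <= sqc z + sqc w.
Proof.
have le2 (x y : R) : - (x ^+ 2 + y ^+ 2) <= 2 * (x * y) <= x ^+ 2 + y ^+ 2.
  have := sqr_ge0 (x + y); have := sqr_ge0 (x - y); rewrite !expr2.
  by move=> ? ?; apply/andP; split; lra.
case: z w => [a b] [c d]; rewrite /sqc/= !ler_norml.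
have := (le2 a c, le2 b d, le2 a d, le2 b c).
move=> [[[/andP[? ?] /andP[? ?]] /andP[? ?]] /andP[? ?]].
have : 0 <= a ^+ 2 + b ^+ 2 + (c ^+ 2 + d ^+ 2) by rewrite !addr_ge0// sqr_ge0.
by move=> ?; split; apply/andP; split; lra.
Qed.

Lemma summable_Re_mulJ u v : summable_fun (fun i => complex.Re (u i * (v i)^*)).
Proof.
apply: (@summable_fun_le _ _ _ (fun i => sqc (u i) + sqc (v i))) => [i|].
  by have [] := Re_Im_mulJ_le (u i) (v i).
by apply: summable_funD; exact: l2_summable.
Qed.

Lemma summable_Im_mulJ u v : summable_fun (fun i => complex.Im (u i * (v i)^*)).
Proof.
apply: (@summable_fun_le _ _ _ (fun i => sqc (u i) + sqc (v i))) => [i|].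
  by have [] := Re_Im_mulJ_le (u i) (v i).
by apply: summable_funD; exact: l2_summable.
Qed.

Definition l2ip u v : C := usum (fun i => complex.Re (u i * (v i)^*)) +i*
                           usum (fun i => complex.Im (u i * (v i)^*)).

Lemma l2ip_sym u v : l2ip u v = (-1) ^+ false * Num.conj (l2ip v u).
Proof.
rewrite expr0 mul1r /l2ip /=; apply/eqP; rewrite eq_complex/=; apply/andP; split.
  by apply/eqP/eq_usum => i; case: (u i) (v i) => [a b] [c d] /=; ring.
rewrite -mulN1r -usumZ; last exact: summable_Im_mulJ.
by apply/eqP/eq_usum => i; case: (u i) (v i) => [a b] [c d] /=; ring.
Qed.

Lemma l2ip_linear w k u v : l2ip (k *: u + v) w = k * l2ip u w + l2ip v w.
Proof.
have sR := summable_Re_mulJ; have sI := summable_Im_mulJ.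
have e i : (k *: u + v) i * (w i)^* = k * (u i * (w i)^*) + v i * (w i)^*.
  by rewrite l2D l2Z mulrDl mulrA.
rewrite /l2ip (eq_usum (fun i => congr1 (@complex.Re R) (e i))).
rewrite (eq_usum (fun i => congr1 (@complex.Im R) (e i))).
apply/eqP; rewrite eq_complex; case: k {e} => a b /=; apply/andP; split.
  rewrite -(usumZ a (sR u w)) -mulNr -(usumZ (- b) (sI u w)).
  rewrite -usumD; [|exact: summable_funZ..].
  rewrite -usumD; [|by apply: summable_funD; exact: summable_funZ|exact: sR].
  apply/eqP/eq_usum => i.
  by case: (u i * _) (v i * _) => [? ?] [? ?] /=; ring.
rewrite -(usumZ a (sI u w)) -(usumZ b (sR u w)).
rewrite -usumD; [|exact: summable_funZ..].
rewrite -usumD; [|by apply: summable_funD; exact: summable_funZ|exact: sI].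
apply/eqP/eq_usum => i.
by case: (u i * _) (v i * _) => [? ?] [? ?] /=; ring.
Qed.

Lemma l2ip_bilinear :
  bilinear_for ( *%R : GRing.Scale.law C C) (Num.conj \; *%R) l2ip.
Proof.
split=> [w k u v|u k v w]; first exact: l2ip_linear.
rewrite /= [LHS]l2ip_sym [l2ip u v]l2ip_sym [l2ip u w]l2ip_sym l2ip_linear.
by rewrite !expr0 !mul1r rmorphD rmorphM.
Qed.

Lemma l2ip_norm u : l2ip u u = (l2sq u)%:C.
Proof.
apply/eqP; rewrite eq_complex /=; apply/andP; split; apply/eqP.
  by apply: eq_usum => i; case: (u i) => [a b]; rewrite /sqc /=; ring.
rewrite -[RHS](mul0r (usum (fun i => sqc (u i)))) -usumZ; last exact: l2_summable.
by apply: eq_usum => i; case: (u i) => [a b] /=; ring.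
Qed.

Lemma l2ip_gt0 u : u != 0 -> 0 < l2ip u u.
Proof.
move=> u0; rewrite l2ip_norm ltcR lt_neqAle l2sq_ge0 andbT eq_sym.
by apply: contra u0 => /eqP/l2sq_eq0 ->.
Qed.

HB.instance Definition _ := @bilinear_isBilinear.Build C l2 l2 C
  ( *%R : GRing.Scale.law C C) (Num.conj \; *%R) l2ip l2ip_bilinear.
HB.instance Definition _ :=
  @isHermitianSesquilinear.Build C l2 false Num.conj l2ip l2ip_sym.
HB.instance Definition _ := @isDotProduct.Build C l2 l2ip l2ip_gt0.

Lemma l2_is_hilbert : is_hilbert (l2ip : {dot l2 for Num.conj}).
Proof.
move=> v; rewrite l2_normE -rmorphXn/= sqr_sqrtr ?l2sq_ge0//.
by rewrite l2ip_norm.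
Qed.

End SquareSummable.

(** * The shift representation and superharmonic functions *)

Section ShiftRepresentation.
Variables (R : realType) (G : groupType) (X : choiceType) (act : G -> X -> X).
Hypothesis actP : is_group_action act.
Local Notation C := R[i].
Local Notation l2 := (l2 R X).

Lemma group_actK g : cancel (act g) (act g^-1%g).
Proof. by move=> x; rewrite -(group_actM actP) mulVg (group_act1 actP). Qed.

Lemma group_actVK g : cancel (act g^-1%g) (act g).
Proof. by move=> x; rewrite -(group_actM actP) mulgV (group_act1 actP). Qed.

Fact l2shift_subproof g (u : l2) :
  (fun x => u (act g^-1%g x)) \in @sq_summable R X.
Proof.
apply/asboolP.
by have [] := usum_reindex (group_actVK g) (group_actK g) (l2_summable u).
Qed.

(** The permutation representation; the inverse turns composition with the action into a left action
    on functions. *)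
Definition l2shift g (u : l2) : l2 := L2 (l2shift_subproof g u).

Lemma l2shift_is_linear g : linear (l2shift g).
Proof. by move=> k u v; apply: l2_ext. Qed.

HB.instance Definition _ g :=
  GRing.isLinear.Build C l2 l2 *:%R (l2shift g) (l2shift_is_linear g).

Lemma l2sq_shift g u : l2sq (l2shift g u) = l2sq u.
Proof. by have [] := usum_reindex (group_actVK g) (group_actK g) (l2_summable u). Qed.

Lemma l2shift_unitary : @is_unitary_representation R G l2
  (@l2ip R X : {dot l2 for Num.conj}) (fun g => l2shift g : {linear l2 -> l2}).
Proof.
split=> [u|g h u|g u v].
- by apply: l2_ext => x /=; rewrite invg1 (group_act1 actP).
- by apply: l2_ext => x /=; rewrite invMg (group_actM actP).
- have [_ e1] := usum_reindex (group_actVK g) (group_actK g) (summable_Re_mulJ u v).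
  have [_ e2] := usum_reindex (group_actVK g) (group_actK g) (summable_Im_mulJ u v).
  by rewrite /= /l2ip -[in RHS]e1 -[in RHS]e2.
Qed.

(** An invariant vector is constant along orbits. If it is nonzero at [x], an infinite orbit of [x]
    would contain enough points to exceed its square norm. *)
Lemma invariant_vector_finite_orbit :
  @has_invariant_vector R G l2 (fun g => l2shift g : {linear l2 -> l2}) ->
  exists x, finite_set (range (act^~ x)).
Proof.
move=> [v v0 vinv].
have [x vx0] : exists x, v x != 0.
  apply: contrapT => nx; move/negP: v0; apply; apply/eqP; apply: l2_ext => x.
  by apply: contrapT => vx; apply: nx; exists x; apply/eqP.
exists x; apply: contrapT => infO.
have c0 : 0 < sqc (v x).
  by rewrite lt_neqAle sqc_ge0 andbT eq_sym; apply: contra vx0 => /eqP/sqc_eq0 ->.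
have [n nM] : exists n : nat, l2sq v / sqc (v x) < n%:R.
  by exists (Num.bound (l2sq v / sqc (v x))); apply: archi_boundP;
     rewrite divr_ge0 ?l2sq_ge0// ltW.
have [J JO Jn] := infinite_set_fset n infO.
have := sum_le_usum J (fun y => sqc_ge0 (v y)) (l2_summable v).
rewrite (eq_big_seq (fun=> sqc (v x))); last first.
  move=> y yJ; have [g _ <-] := JO y yJ; congr (sqc _).
  by rewrite -[in RHS](vinv g^-1%g) /= invgK.
rewrite big_const_seq count_predT iter_addr_0 -/(l2sq v) leNgt => /negP; apply.
move: nM; rewrite ltr_pdivrMr// => /lt_le_trans; apply.
by rewrite -[leRHS]mulr_natl ler_pM2r// ler_nat.
Qed.

Lemma l2sq_parallelogram (u v : l2) :
  l2sq (u + v) + l2sq (u - v) = 2 * (l2sq u + l2sq v).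
Proof.
rewrite /l2sq -usumD; [|exact: l2_summable..].
rewrite -usumD; [|exact: l2_summable..].
rewrite -usumZ; last by apply: summable_funD; exact: l2_summable.
apply: eq_usum => x; rewrite l2D l2B.
by case: (u x) (v x) => [a b] [c d]; rewrite /sqc/=; ring.
Qed.

Local Notation nrm u := (Num.sqrt (l2sq u)).

Lemma nrmD (u v : l2) : nrm (u + v) <= nrm u + nrm v.
Proof. by have := l2norm_triangle u v; rewrite /l2norm -rmorphD/= lecR. Qed.

Lemma nrm0 : nrm (0 : l2) = 0.
Proof. by have := @normr0 C l2; rewrite l2_normE => -[]. Qed.

Lemma nrm_sum_shift (L : seq G) (v : l2) :
  nrm (\sum_(g <- L) l2shift g v) <= (size L)%:R * nrm v.
Proof.
elim: L => [|g L IH]; first by rewrite big_nil nrm0 mul0r.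
rewrite big_cons/= -natr1 mulrDl mul1r.
by apply: le_trans (nrmD _ _) _; rewrite l2sq_shift addrC lerD2r.
Qed.

(** Some [g] in [L] moves [v] substantially, so by the parallelogram law [v + g v] is shorter than
    [2 |v|] by a definite factor. The identity in front of [L] provides the [v] paired with [g v];
    each other term costs at most [|v|]. *)
Lemma nrm_average_le (L : seq G) (e : R) (v : l2) : 0 <= e ->
  (v != 0 -> exists2 g, g \in L & e * nrm v <= nrm (l2shift g v - v)) ->
  nrm (\sum_(g <- 1%g :: L) l2shift g v) <=
    ((size L)%:R - 1 + Num.sqrt (4 - e ^+ 2)) * nrm v.
Proof.
move=> e0 gap; have [->|v0] := eqVneq v 0.
  by rewrite nrm0 mulr0 big1 ?nrm0// => g _; rewrite linear0.
have [g gL ge] := gap v0.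
have sh1 : l2shift 1%g v = v by apply: (unitary_rep1 l2shift_unitary).
rewrite big_cons sh1 (big_rem _ gL)/= addrA.
apply: le_trans (nrmD _ _) _.
have srem : nrm (\sum_(h <- rem g L) l2shift h v) <= ((size L)%:R - 1) * nrm v.
  apply: le_trans (nrm_sum_shift (rem g L) v) _.
  by rewrite size_rem// -subn1 natrB// lt0n size_eq0; apply/eqP => L0; rewrite L0 in gL.
rewrite mulrDl [leRHS]addrC; apply: lerD srem.
have ge2 : e ^+ 2 * l2sq v <= l2sq (l2shift g v - v).
  rewrite -[l2sq v]sqr_sqrtr ?l2sq_ge0// -[leRHS]sqr_sqrtr ?l2sq_ge0//.
  by rewrite -exprMn ler_sqr ?nnegrE ?mulr_ge0 ?sqrtr_ge0.
have := l2sq_parallelogram (l2shift g v) v; rewrite l2sq_shift => pg.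
have le4 : l2sq (v + l2shift g v) <= (4 - e ^+ 2) * l2sq v.
  by rewrite addrC; lra.
have v_gt0 : 0 < l2sq v.
  rewrite lt_neqAle l2sq_ge0 andbT eq_sym.
  by apply: contra v0 => /eqP/l2sq_eq0 ->.
(* The estimate itself forces [4 - e ^+ 2] to be nonnegative, so its square root is a genuine
   one. *)
have : 0 <= (4 - e ^+ 2) * l2sq v by apply: le_trans le4; exact: l2sq_ge0.
rewrite pmulr_lge0// => e4.
by rewrite -sqrtrM// ler_sqrt// mulr_ge0// ltW.
Qed.

Lemma sum_delta_le1 (x0 : X) (J : {fset X}) :
  \sum_(x <- J) `|sqc ((x == x0)%:R : C)| <= 1.
Proof.
have e x : `|sqc ((x == x0)%:R : C)| = (x == x0)%:R :> R.
  by case: (x == x0); rewrite /sqc/= ?expr1n expr0n addr0 ?normr0 ?normr1.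
under eq_bigr do rewrite e.
case: (boolP (x0 \in J)) => x0J; last first.
  rewrite big_seq big1 ?ler01// => x xJ.
  by case: eqP => // xx0; rewrite -xx0 xJ in x0J.
rewrite (big_fsetD1 x0)//= eqxx big_seq big1 ?addr0// => x.
by rewrite !inE => /andP[/negPf->].
Qed.

Fact l2delta_subproof (x0 : X) :
  (fun x => (x == x0)%:R) \in @sq_summable R X.
Proof. by apply/asboolP; exists 1 => J; exact: sum_delta_le1. Qed.

Definition l2delta x0 : l2 := L2 (l2delta_subproof x0).

Lemma nrm_l2delta x0 : nrm (l2delta x0) <= 1.
Proof.
rewrite -[leRHS]sqrtr1 ler_sqrt ?ler01//; apply: usum_le => [|J].
  exact: l2_summable.
apply: le_trans (sum_delta_le1 x0 J); apply: ler_sum => x _; exact: ler_norm.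
Qed.

Lemma Re_l2sum (s : seq G) (F : G -> l2) x :
  complex.Re ((\sum_(g <- s) F g) x) = \sum_(g <- s) complex.Re (F g x).
Proof.
have ReD (z w : C) : complex.Re (z + w) = complex.Re z + complex.Re w.
  by case: z w => [? ?] [? ?].
elim: s => [|g s IH]; first by rewrite !big_nil.
by rewrite !big_cons l2D ReD IH.
Qed.

End ShiftRepresentation.

(** The sum over [L] is not normalized: the critical value of [t], reached by constant functions, is
    [size L]. *)
Definition superharmonic (R : realType) (G : groupType) (X : Type)
    (act : G -> X -> X) (L : seq G) (t : R) (u : X -> R) :=
  forall x, \sum_(g <- L) u (act g^-1%g x) <= t * u x.

Section Superharmonic.
Variables (R : realType) (G : groupType) (X : choiceType) (act : G -> X -> X).
Hypothesis actP : is_group_action act.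
Local Notation C := R[i].
Local Notation l2 := (l2 R X).
Local Notation nrm u := (Num.sqrt (l2sq u)).

(** * The Green function of the operator summing over [L] *)

Section Green.
Variables (L : seq G) (M t : R).
Hypothesis M_ge0 : 0 <= M.
Hypothesis ltMt : M < t.
Hypothesis normL : forall v : l2,
  nrm (\sum_(g <- L) l2shift actP g v) <= M * nrm v.
Variable x0 : X.

Let walk n : l2 :=
  iter n (fun v : l2 => \sum_(g <- L) l2shift actP g v) (l2delta R x0).
(** [p n x] is the number of words of length [n] in [L] that carry [x0] to [x], so taking the real
    part loses nothing. *)
Let p n x := complex.Re (walk n x).
Let green x := limn (series (fun n => p n x / t ^+ n)).

Let t_gt0 : 0 < t. Proof. exact: le_lt_trans ltMt. Qed.

Let pS n x : p n.+1 x = \sum_(g <- L) p n (act g^-1%g x).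
Proof. by rewrite /p /walk iterS Re_l2sum. Qed.

Let p_ge0 n x : 0 <= p n x.
Proof.
elim: n x => [|n IH] x; last by rewrite pS sumr_ge0.
by rewrite /p /=; case: (x == x0).
Qed.

(** A coordinate is at most the norm, and each step multiplies the norm by at most [M]. The Green
    series is thus dominated by a geometric series of ratio [M / t < 1]. *)
Let p_le n x : p n x <= M ^+ n.
Proof.
apply: (@le_trans _ _ (nrm (walk n))).
  rewrite -[leLHS]ger0_norm ?p_ge0// -sqrtr_sqr ler_sqrt ?l2sq_ge0//.
  apply: le_trans (sqc_le_l2sq (walk n) x).
  by rewrite /sqc lerDl sqr_ge0.
elim: n => [|n IH]; first exact: nrm_l2delta.
by rewrite exprS; apply: le_trans (normL _) _; exact: ler_wpM2l.
Qed.

Let term_ge0 n x : 0 <= p n x / t ^+ n.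
Proof. by rewrite divr_ge0// exprn_ge0// ltW. Qed.

Let green_cvg x : cvgn (series (fun n => p n x / t ^+ n)).
Proof.
apply: (@series_le_cvg _ _ (geometric 1 (M / t))) => // [n|n|].
- by rewrite /geometric/= mul1r exprn_ge0// divr_ge0// ltW.
- by rewrite /geometric/= mul1r expr_div_n ler_pM2r ?invr_gt0 ?exprn_gt0//.
- apply: is_cvg_geometric_series.
  by rewrite ger0_norm ?divr_ge0 ?(ltW t_gt0)// ltr_pdivrMr// mul1r.
Qed.

Let series_le_green n x : series (fun n => p n x / t ^+ n) n <= green x.
Proof.
apply: nondecreasing_cvgn_le; last exact: green_cvg.
by apply: nondecreasing_series => k _ _; exact: term_ge0.
Qed.

Lemma green_superharmonic : exists u : X -> R,
  [/\ forall x, 0 <= u x, 0 < u x0 & superharmonic act L t u].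
Proof.
exists green; split.
- by move=> x; apply: le_trans (series_le_green 0 x); rewrite /series/= big_geq.
- apply: lt_le_trans (series_le_green 1 x0).
  by rewrite /series/= big_nat1 expr0 divr1 /p/= eqxx.
move=> x.
have cv : (fun n => \sum_(g <- L)
    series (fun n => p n (act g^-1%g x) / t ^+ n) n) @ \oo -->
    \sum_(g <- L) green (act g^-1%g x).
  by apply: cvg_big; [exact: add_continuous|move=> g _; exact: green_cvg].
rewrite -(cvg_lim _ cv)//; apply: limr_le; first exact: cvgP cv.
apply: nearW => n.
apply: (@le_trans _ _ (t * series (fun n => p n x / t ^+ n) n.+1)); last first.
  by rewrite ler_pM2l.
(* Summing over [L] shifts the series by one index: it yields [t] times the next partial sum without
   its term of index 0, which is nonnegative. *)
rewrite /series/= exchange_big big_nat_recl//= mulrDr expr0 divr1.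
rewrite mulr_sumr -[leLHS]add0r; apply: lerD.
  by rewrite mulr_ge0// ltW.
apply: ler_sum => k _; rewrite -mulr_suml -pS.
have tn0 : t != 0 by rewrite gt_eqF.
suff -> : t * (p k.+1 x / t ^+ k.+1) = p k.+1 x / t ^+ k by [].
by rewrite exprS invfM mulrCA (mulrA t) mulfV// mul1r.
Qed.

End Green.

(** * Gluing superharmonic functions over connected components *)

Section Gluing.
Variables (L : seq G) (t : R).
Hypothesis LV : perm_eq L [seq g^-1%g | g <- L].

Let memLV g : g \in L -> g^-1%g \in L.
Proof. by move=> gL; rewrite (perm_mem LV) map_f. Qed.

(** The component of [x], as the predicate of being reachable by a word in [L]. Symmetry of [L]
    makes the predicates of neighbours equal, so that a base point can be chosen as a function of
    the component. *)
Let conn x y := exists2 s : seq G, {subset s <= L} & foldr act x s = y.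

Let conn_act g x : g \in L -> conn (act g x) = conn x.
Proof.
move=> gL; have sub (h : G) (s : seq G) z y : h \in L ->
    {subset s <= L} -> foldr act (act h z) s = y -> conn z y.
  move=> hL sL e; exists (rcons s h); last by rewrite foldr_rcons.
  by move=> k; rewrite mem_rcons inE => /orP[/eqP->//|/sL].
apply/funext => y; apply/propext; split=> -[s sL sy]; first exact: sub gL sL sy.
apply: (sub g^-1%g s); [exact: memLV|exact: sL|].
by rewrite (group_actK actP).
Qed.

(** On each component, take the function attached to a chosen base point. The points compared by
    superharmonicity lie in one component, so the inequality survives. *)
Lemma superharmonic_glue :
  (forall x0, exists u : X -> R,
    [/\ forall x, 0 <= u x, 0 < u x0 & superharmonic act L t u]) ->
  exists2 u : X -> R, (forall x, 0 < u x) & superharmonic act L t u.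
Proof.
move=> /choice[u uP].
have conn_ex x : exists y, conn x y by exists x, [::].
pose rep x := sval (cid (conn_ex x)).
have rep_eq x y : conn x = conn y -> rep x = rep y.
  rewrite /rep; move: (conn_ex x) (conn_ex y) => + + e; rewrite e => a b.
  by rewrite (Prop_irrelevance a b).
(* Minimum principle: where a nonnegative superharmonic function vanishes, it vanishes at all
   neighbours. Positivity therefore travels back along the word from [y] to [x]. *)
have pos x0 x y : conn x y -> 0 < u x0 y -> 0 < u x0 x.
  have [u0 _ uS] := uP x0.
  move=> [s + <-]; elim: s => //= g s IH sL ug; apply: IH.
    by move=> h hs; apply: sL; rewrite inE hs orbT.
  rewrite lt_neqAle u0 andbT; apply/eqP => e0.
  have gL : g^-1%g \in L by apply/memLV/sL; rewrite inE eqxx.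
  have := uS (foldr act x s); rewrite -e0 mulr0 (big_rem _ gL)/= invgK.
  rewrite leNgt => /negP; apply; rewrite ltr_wpDr// sumr_ge0// => h _.
exists (fun x => u (rep x) x).
  move=> x; have [_ up _] := uP (rep x); apply: pos up.
  by rewrite /rep; case: cid.
move=> x; have [_ _ uS] := uP (rep x).
apply: le_trans (uS x); rewrite le_eqVlt; apply/orP; left; apply/eqP.
apply: eq_big_seq => g gL; congr u; apply: rep_eq.
by apply: conn_act; exact: memLV.
Qed.

End Gluing.

(** Infinite orbits exclude invariant vectors, so the Kazhdan pair moves every nonzero vector. The
    operator summing over [L] then has norm at most [M < size L], leaving room for a Green
    function. *)
Lemma kazhdan_superharmonic : kazhdan_property_T R G ->
  (forall x, infinite_set (range (act^~ x))) ->
  exists (L : seq G) (t : R) (u : X -> R),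
    [/\ perm_eq L [seq g^-1%g | g <- L], t < (size L)%:R,
      (forall x, 0 < u x) & superharmonic act L t u].
Proof.
move=> [K [e [finK e0 KT]]] infO.
have [s sK] : exists s : seq G, K = [set` s] by exact/finite_seqP.
pose L' := s ++ [seq g^-1%g | g <- s]; pose L := 1%g :: L'.
pose d : R := Num.min e 1.
have d0 : 0 < d by rewrite lt_min e0 ltr01.
have d1 : d <= 1 by rewrite ge_min lexx orbT.
have gap (v : l2) : v != 0 ->
    exists2 g, g \in L' & d * nrm v <= nrm (l2shift actP g v - v).
  move=> v0; apply: contrapT => nogap.
  have ai : @has_almost_invariant_vector R G l2
      (fun g => l2shift actP g : {linear l2 -> l2}) K e.
    exists v => // g Kg; rewrite !l2_normE -rmorphM/= ltcR.
    rewrite ltNge; apply/negP => ev; apply: nogap; exists g.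
      by rewrite mem_cat; move: Kg; rewrite sK /= => ->.
    by apply: le_trans ev; rewrite ler_wpM2r ?sqrtr_ge0// ge_min lexx.
  have /invariant_vector_finite_orbit[x] :=
    KT l2 (@l2ip R X) (fun g => l2shift actP g) (@l2_is_hilbert R X)
      (l2shift_unitary R actP) ai.
  exact: infO.
pose M := (size L')%:R - 1 + Num.sqrt (4 - d ^+ 2).
have MN : M < (size L)%:R.
  rewrite /M /= -[ltRHS]natr1; suff : Num.sqrt (4 - d ^+ 2) < 2 by lra.
  rewrite -[ltRHS]ger0_norm// -sqrtr_sqr ltr_sqrt.
    by have := exprn_gt0 2 d0; lra.
  by rewrite exprn_gt0.
have LV : perm_eq L [seq g^-1%g | g <- L].
  rewrite /L /L' /= invg1 perm_cons map_cat.
  suff -> : [seq g^-1%g | g <- [seq g^-1%g | g <- s]] = s by rewrite perm_catC.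
  by rewrite -map_comp -[RHS]map_id; apply: eq_map => g; exact: invgK.
(* The midpoint lies strictly above the norm bound [M], as convergence requires, and strictly below
   [size L]. *)
exists L, ((M + (size L)%:R) / 2).
suff [u u0 uS] : exists2 u : X -> R, (forall x, 0 < u x) &
    superharmonic act L ((M + (size L)%:R) / 2) u.
  by exists u; split => //; lra.
apply: superharmonic_glue => // x0.
(* Applied to a delta function, the gap shows that [L'] is not empty. *)
have M0 : 0 <= M.
  have [|g gL _] := gap (l2delta R x0).
    apply/eqP => /(congr1 (fun w : l2 => w x0)) /= /eqP.
    by rewrite eqxx oner_eq0.
  rewrite addr_ge0 ?sqrtr_ge0// subr_ge0 ler1n lt0n size_eq0.
  by apply/eqP => L0; rewrite L0 in gL.
apply: (@green_superharmonic L M) => //; first lra.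
by move=> v; apply: nrm_average_le => [|/gap//]; exact: ltW.
Qed.

End Superharmonic.

(** * Finitely additive means *)

Section FinitelyAdditiveMean.
Variables (R : realType) (X : Type) (mu : set X -> R).
Hypothesis muP : is_finitely_additive_probability mu.

Lemma fap_set0 : mu set0 = 0.
Proof.
have := fap_setU muP (setI0 set0); rewrite setU0 => /eqP.
by rewrite -subr_eq0 opprD addNKr oppr_eq0 => /eqP.
Qed.

Lemma fap_split A B : mu B = mu (A `&` B) + mu (B `\` A).
Proof.
rewrite -(fap_setU muP); last first.
  by apply/seteqP; split => // x [[Ax _] [_ /(_ Ax)]].
by rewrite setIC setUIDK.
Qed.

Lemma fap_le A B : A `<=` B -> mu A <= mu B.
Proof.
move=> AB; rewrite (fap_split A B) (setIidl AB) lerDl; exact: fap_ge0.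
Qed.

(** A simple function is a list of weighted sets that may overlap, so adding functions is
    concatenating lists. *)
Definition simple_eval (s : seq (R * set X)) x := \sum_(p <- s) p.1 * \1_(p.2) x.

Definition simple_mean (s : seq (R * set X)) := \sum_(p <- s) p.1 * mu p.2.

(** Localizing to [B] makes the induction work: the head set [A] splits [B] into a piece where the
    tail is at most [c - a] and one where it is at most [c]. *)
Lemma simple_mean_le_on s B (c : R) : (forall x, B x -> simple_eval s x <= c) ->
  \sum_(p <- s) p.1 * mu (p.2 `&` B) <= c * mu B.
Proof.
elim: s B c => [|[a A] s IH] B c sc.
  (* The constant [c] is nonnegative as soon as [B] has a point; otherwise [mu B] is zero. *)
  rewrite big_nil; have [[x Bx]|nB] := pselect (exists x, B x).
    by apply: mulr_ge0; [have := sc x Bx; rewrite /simple_eval big_nil|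
                         exact: fap_ge0].
  suff -> : B = set0 by rewrite fap_set0 mulr0.
  by apply/seteqP; split => // x Bx; apply: nB; exists x.
rewrite big_cons/=.
have sE x : simple_eval ((a, A) :: s) x = a * \1_A x + simple_eval s x.
  by rewrite /simple_eval big_cons.
have hA : \sum_(p <- s) p.1 * mu (p.2 `&` (A `&` B)) <= (c - a) * mu (A `&` B).
  apply: IH => x [Ax Bx]; have := sc x Bx.
  by rewrite sE indicE mem_set// mulr1; lra.
have hD : \sum_(p <- s) p.1 * mu (p.2 `&` (B `\` A)) <= c * mu (B `\` A).
  apply: IH => x [Bx nAx]; have := sc x Bx.
  by rewrite sE indicE memNset// mulr0 add0r.
rewrite (eq_bigr (fun p => p.1 * mu (p.2 `&` (A `&` B)) +
                           p.1 * mu (p.2 `&` (B `\` A)))); last first.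
  move=> p _; rewrite -mulrDr (fap_split A (p.2 `&` B)).
  by rewrite setICA setIDA.
rewrite big_split/= (fap_split A B); lra.
Qed.

Lemma simple_mean_le s (c : R) : (forall x, simple_eval s x <= c) ->
  simple_mean s <= c.
Proof.
move=> sc; have := @simple_mean_le_on s setT c (fun x _ => sc x).
rewrite (fap_setT muP) mulr1; apply: le_trans; rewrite le_eqVlt.
by apply/orP; left; apply/eqP/eq_bigr => p _; rewrite setIT.
Qed.

Lemma simple_mean_ge s (c : R) : (forall x, c <= simple_eval s x) ->
  c <= simple_mean s.
Proof.
move=> sc.
have := @simple_mean_le [seq (- p.1, p.2) | p <- s] (- c).
rewrite /simple_mean big_map/=.
under eq_bigr do rewrite mulNr.
rewrite sumrN lerN2; apply => x.
rewrite /simple_eval big_map/=.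
by under eq_bigr do rewrite mulNr; rewrite sumrN lerN2; exact: sc.
Qed.

(** Layer-cake approximation: if [0 <= f <= B], this simple function is [f] rounded down to a
    multiple of [1 / (n + 1)]. *)
Definition layers (n B : nat) (f : X -> R) : seq (R * set X) :=
  [seq (n.+1%:R^-1, [set x | k.+1%:R <= n.+1%:R * f x]) | k <- iota 0 (B * n.+1)].

(** The sum counts the positive integers up to both [m] and [y]: it is the integer part of [y],
    capped at [m]. *)
Lemma count_layers m (y : R) : 0 <= y ->
  \sum_(k <- iota 0 m) (k.+1%:R <= y)%R%:R <= y /\
  (y <= m%:R -> y - 1 <= \sum_(k <- iota 0 m) (k.+1%:R <= y)%R%:R).
Proof.
move=> y0; pose c i : R := \sum_(k <- iota 0 i) (k.+1%:R <= y)%R%:R.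
have cS i : c i.+1 = c i + (i.+1%:R <= y)%R%:R.
  by rewrite /c -{1}[i.+1]addn1 iotaD big_cat/= big_seq1 add0n.
have c_le i : c i <= i%:R.
  elim: i => [|i IH]; first by rewrite /c big_nil.
  by rewrite cS -natr1 lerD// lern1; case: (_ <= y)%R.
have c_eq i : i%:R <= y -> c i = i%:R.
  elim: i => [|i IH] iy; first by rewrite /c big_nil.
  by rewrite cS iy IH ?natr1// (le_trans _ iy)// ler_nat.
rewrite -/(c m); elim: m => [|m [IH1 IH2]].
  by rewrite /c big_nil; split => //; lra.
rewrite cS; case: (lerP m.+1%:R y) => my; rewrite ?addr0.
  rewrite c_eq; last by rewrite (le_trans _ my)// ler_nat.
  by rewrite natr1; split => // ?; lra.
split=> // _; case: (lerP y m%:R) => [/IH2//|/ltW ym].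
by rewrite c_eq//; move: my; rewrite -natr1; lra.
Qed.

Lemma layers_eval n B f x : 0 <= f x -> f x <= B%:R ->
  f x - n.+1%:R^-1 <= simple_eval (layers n B f) x <= f x.
Proof.
move=> f0 fB; have n0 : (0 : R) < n.+1%:R by rewrite ltr0n.
have nf0 : 0 <= n.+1%:R * f x by rewrite mulr_ge0// ltW.
have [c1 c2] := @count_layers (B * n.+1) _ nf0.
have -> : simple_eval (layers n B f) x =
    n.+1%:R^-1 * \sum_(k <- iota 0 (B * n.+1)) (k.+1%:R <= n.+1%:R * f x)%R%:R.
  rewrite /simple_eval /layers big_map mulr_sumr; apply: eq_bigr => k _ /=.
  by rewrite indicE; congr (_ * (nat_of_bool _)%:R); apply/idP/idP;
    rewrite inE.
apply/andP; split; last by rewrite ler_pdivrMl.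
have -> : f x - n.+1%:R^-1 = n.+1%:R^-1 * (n.+1%:R * f x - 1).
  by rewrite mulrBr mulr1 mulKf// gt_eqF.
rewrite ler_pM2l ?invr_gt0//; apply: c2.
by rewrite natrM mulrC ler_pM2r.
Qed.

(** * Invariant means against positive superharmonic functions *)

Section Invariant.
Variables (G : groupType) (act : G -> X -> X).
Hypothesis actP : is_group_action act.
Hypothesis mu_inv : invariant_under act mu.

(** The superlevel sets of [f \o act g] are the images under [g^-1] of those of [f], so invariance
    is exact for each [n], before any limit. *)
Lemma mean_layers_act n B f g :
  simple_mean (layers n B (f \o act g)) = simple_mean (layers n B f).
Proof.
rewrite /simple_mean /layers !big_map; apply: eq_bigr => k _ /=; congr (_ * _).
rewrite -[RHS](mu_inv g^-1%g); congr mu; apply/seteqP; split => [x fx|_ [x fx <-]].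
  exists (act g x) => //.
  by rewrite -(group_actM actP) mulVg (group_act1 actP).
by rewrite /= -(group_actM actP) mulgV (group_act1 actP).
Qed.

Lemma superharmonic_size_le (L : seq G) (t : R) (u : X -> R) :
  perm_eq L [seq g^-1%g | g <- L] -> (forall x, 0 < u x) ->
  superharmonic act L t u -> (size L)%:R <= t.
Proof.
move=> LV u0 uS; pose r g x := u (act g^-1%g x) / u x.
have r0 g x : 0 < r g x by exact: divr_gt0.
have rt x : \sum_(g <- L) r g x <= t.
  by rewrite -mulr_suml ler_pdivrMr//; exact: uS.
have rgt g x : g \in L -> r g x <= t.
  move=> gL; apply: le_trans (rt x); rewrite (big_rem _ gL)/= lerDl.
  by rewrite sumr_ge0// => h _; exact: ltW.
have [B tB] : exists B : nat, t <= B%:R.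
  by exists (Num.bound `|t|); apply: le_trans (ler_norm t) _;
    exact/ltW/archi_boundP.
have memLV g : g \in L -> g^-1%g \in L.
  by move=> gL; rewrite (perm_mem LV) map_f.
(* The mean is only applied to the approximations [layers n], each within [1 / (n + 1)] of its
   function; this is the source of the error term. *)
have key n : (size L)%:R * (1 - n.+1%:R^-1) <= t.
  pose m g := simple_mean (layers n B (r g)).
  have le_t : \sum_(g <- L) m g <= t.
    have := @simple_mean_le (flatten [seq layers n B (r g) | g <- L]) t.
    rewrite /simple_mean big_flatten big_map; apply => x.
    rewrite /simple_eval big_flatten big_map.
    apply: le_trans (rt x); rewrite big_seq [leRHS]big_seq.
    apply: ler_sum => g gL.
    have /andP[_] := layers_eval n (ltW (r0 g x)) (le_trans (rgt g x gL) tB).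
    exact.
  (* Translating by [g^-1] turns [r g^-1] into the inverse of [r g], and [y + 1 / y >= 2] for
     positive [y]; the two roundings cost [2 / (n + 1)]. *)
  have ge2 g : g \in L -> 2 - 2 * n.+1%:R^-1 <= m g + m g^-1%g.
    move=> gL; rewrite -[m g^-1%g](@mean_layers_act _ _ _ g^-1%g).
    have <- : simple_mean (layers n B (r g) ++
        layers n B (r g^-1%g \o act g^-1%g)) =
        m g + simple_mean (layers n B (r g^-1%g \o act g^-1%g)).
      by rewrite /simple_mean big_cat.
    apply: simple_mean_ge => x.
    have /andP[e1 _] := layers_eval n (ltW (r0 g x)) (le_trans (rgt g x gL) tB).
    have /andP[e2 _] := @layers_eval n B (r g^-1%g \o act g^-1%g) x
      (ltW (r0 _ _)) (le_trans (rgt _ _ (memLV g gL)) tB).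
    have -> : simple_eval (layers n B (r g) ++
        layers n B (r g^-1%g \o act g^-1%g)) x =
        simple_eval (layers n B (r g)) x +
        simple_eval (layers n B (r g^-1%g \o act g^-1%g)) x.
      by rewrite /simple_eval big_cat.
    have rV : (r g^-1%g \o act g^-1%g) x = (r g x)^-1.
      rewrite /= /r invgK -(group_actM actP) mulgV (group_act1 actP).
      by rewrite invf_div.
    rewrite rV in e2.
    suff h2 : 2 <= r g x + (r g x)^-1.
      by apply: le_trans (lerD e1 e2); rewrite addrACA -opprD mulr_natl lerD2r.
    rewrite -subr_ge0.
    have -> : r g x + (r g x)^-1 - 2 = (r g x - 1) ^+ 2 / r g x.
      by field; rewrite gt_eqF.
    by rewrite divr_ge0 ?sqr_ge0// ltW.
  have mV : \sum_(g <- L) m g^-1%g = \sum_(g <- L) m g.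
    by rewrite [RHS](perm_big _ LV)/= big_map.
  have : \sum_(g <- L) (2 - 2 * n.+1%:R^-1) <= \sum_(g <- L) (m g + m g^-1%g).
    by rewrite big_seq [leRHS]big_seq; exact: ler_sum.
  rewrite [leRHS]big_split/= mV big_const_seq count_predT iter_addr_0.
  have -> : (2 - 2 * n.+1%:R^-1) *+ size L =
      2 * ((size L)%:R * (1 - n.+1%:R^-1)) :> R.
    by rewrite [RHS]mulrCA [2 * (1 - _)]mulrBr mulr1 [RHS]mulr_natl.
  move=> h; rewrite -(ler_pM2l (ltr0Sn R 1)); apply: le_trans h _.
  by rewrite mulr_natl mulr2n lerD.
rewrite leNgt; apply/negP => tL.
(* This [n] makes the error [size L / (n + 1)] smaller than the gap [size L - t]. *)
pose n := Num.bound ((size L)%:R / ((size L)%:R - t)).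
have d0 : 0 < (size L)%:R - t by rewrite subr_gt0.
have : (size L)%:R / ((size L)%:R - t) < n.+1%:R.
  apply: (@lt_trans _ _ n%:R); last by rewrite ltr_nat.
  by apply: archi_boundP; rewrite divr_ge0// ltW.
rewrite ltr_pdivrMr// mulrC -ltr_pdivrMr ?ltr0n//.
have := key n; rewrite mulrBr mulr1.
by move: ((size L)%:R / n.+1%:R : R) => z *; lra.
Qed.

End Invariant.
End FinitelyAdditiveMean.

(** * Finite orbits and finite quotients *)

Section FiniteOrbit.
Variables (G : groupType) (X : choiceType) (act : G -> X -> X).
Hypothesis actP : is_group_action act.
Variable x0 : X.
Hypothesis finO : finite_set (range (act^~ x0)).

Let O : {fset X} := fset_set (range (act^~ x0)).

Let act_O g x : x \in O -> act g x \in O.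
Proof.
rewrite !in_fset_set// => /set_mem[h _ <-]; apply/mem_set; exists (g * h)%g => //.
exact: (group_actM actP).
Qed.

Let orbit_act g (x : O) : O := FSetSub (act_O g (fsvalP x)).

Let orbit_act_inj g : injective (orbit_act g).
Proof.
by move=> x y /(congr1 val)/= /(can_inj (group_actK actP g))/val_inj.
Qed.

(* The inverse compensates for [{perm T}] composing from left to right. *)
Definition orbit_perm g : {perm O} := perm (@orbit_act_inj g^-1%g).

Lemma orbit_permM : {morph orbit_perm : g h / (g * h)%g}.
Proof.
move=> g h; apply/permP => x; rewrite permM !permE; apply: val_inj => /=.
by rewrite invMg (group_actM actP).
Qed.

HB.instance Definition _ := isMultiplicative.Build G {perm O} orbit_perm orbit_permM.

(** The permutations of the finite orbit form a finite group, in which [g] is nontrivial because it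
    moves [x0]. *)
Lemma finite_orbit_separates g : act g x0 <> x0 ->
  exists (F : finGroupType) (f : {multiplicative G -> F}), f g <> 1%g.
Proof.
move=> gx0; exists {perm O}, orbit_perm => og1; apply: gx0.
have x0O : x0 \in O.
  by rewrite in_fset_set//; apply/mem_set; exists 1%g => //; exact: group_act1.
have := congr1 (fun s : {perm O} => val (s (FSetSub x0O))) og1.
rewrite /= permE perm1/= => e.
by rewrite -[in LHS]e -(group_actM actP) mulgV (group_act1 actP).
Qed.

End FiniteOrbit.

Section PairMorphism.
Variables (G : groupType) (F1 F2 : finGroupType).
Variables (f1 : {multiplicative G -> F1}) (f2 : {multiplicative G -> F2}).

Definition pair_mor (g : G) : F1 * F2 := (f1 g, f2 g).

Lemma pair_morM : {morph pair_mor : g h / (g * h)%g}.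
Proof. by move=> g h; rewrite /pair_mor !gmulfM. Qed.

HB.instance Definition _ :=
  isMultiplicative.Build G (F1 * F2)%type pair_mor pair_morM.

End PairMorphism.

(** Take the product of finite quotients that detect the successive elements, starting from the
    trivial morphism. *)
Lemma residually_finite_seq (G : groupType) (s : seq G) : residually_finite G ->
  exists (F : finGroupType) (f : {multiplicative G -> F}),
    forall g, g \in s -> g <> 1%g -> f g <> 1%g.
Proof.
move=> rfG; elim: s => [|h s [F [f fP]]].
  by exists {perm unit}, (@one_fun G {perm unit}).
have [h1|h1] := eqVneq h 1%g.
  exists F, f => g; rewrite inE => /orP[/eqP->|]; last exact: fP.
  by rewrite h1.
have [F' [f' f'h]] := rfG h (elimN eqP h1).
exists (F' * F)%type, (pair_mor f' f) => g.
rewrite inE => /orP[/eqP-> _ [+ _]//|gs g1 [_]]; exact: fP.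
Qed.

(** By compactness the image filter has a cluster point. If the preimage of a neighbourhood were not
    in [U], its complement would be, against clustering. *)
Lemma ultrafilter_cvg_itv (R : realType) (T : Type) (U : set_system T)
    (f : T -> R) : UltraFilter U -> (forall t, 0 <= f t <= 1) -> cvg (f @ U).
Proof.
move=> UU f01.
have fU : (f @ U) [set x | x \in `[0, 1]].
  by apply: (@filterE _ U) => t; rewrite /= in_itv /=.
have [p [_ pcl]] := @segment_compact R 0 1 (f @ U) _ fU.
apply/cvg_ex; exists p => V Vp.
have [//|nV] := in_ultra_setVsetC (f @^-1` V) UU.
by have [x [nVx Vx]] := pcl (~` V) V nV Vp.
Qed.

(** * The ultralimit of counting measures on finite quotients *)

Section UltraMean.
Variables (R : realType) (G : groupType).
Variables (F : {fset G} -> finGroupType) (f : forall S, {multiplicative G -> F S}).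
Hypothesis fP : forall (S : {fset G}) g, g \in S -> g <> 1%g -> f S g <> 1%g.
Variable U : set_system {fset G}.
Hypothesis UU : UltraFilter U.
Hypothesis totallyU : totally `<=` U.

Let X := {S : {fset G} & F S}.

Definition family_act (g : G) (x : X) : X :=
  existT _ (projT1 x) (f (projT1 x) g * projT2 x)%g.

Lemma family_actP : is_group_action family_act.
Proof.
split=> [[S x]|g h [S x]]; rewrite /family_act /=.
  have -> : f S 1%g = 1%g by apply: (mulgI (f S 1%g)); rewrite -gmulfM !mulg1.
  by rewrite mul1g.
by rewrite gmulfM mulgA.
Qed.

Let slice (A : set X) S : {set F S} := [set x : F S | `[< A (existT _ S x) >]]%SET.

Let density (A : set X) S : R := #|slice A S|%:R / #|F S|%:R.

Let card_gt0 S : (0 : R) < #|F S|%:R.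
Proof. by rewrite ltr0n; apply/card_gt0P; exists 1%g. Qed.

Let density_cvg A : cvg (density A @ U).
Proof.
apply: ultrafilter_cvg_itv => S; rewrite /density divr_ge0//=.
by rewrite ler_pdivrMr// mul1r ler_nat max_card.
Qed.

Definition ultra_mean (A : set X) : R := lim (density A @ U).

Lemma ultra_mean_fap : is_finitely_additive_probability ultra_mean.
Proof.
split=> [A||A B AB].
- apply: limr_ge; first exact: density_cvg.
  by apply: nearW => S; rewrite /density divr_ge0.
- apply: cvg_lim => //.
  have -> : density setT = fun=> 1; last exact: cvg_cst.
  apply/funext => S; rewrite /density.
  have -> : slice setT S = [set: F S]%SET.
    by apply/setP => x; rewrite !inE; apply/asboolP.
  by rewrite cardsT mulfV// gt_eqF.
- apply: cvg_lim => //.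
  have -> : density (A `|` B) = density A \+ density B.
    apply/funext => S; rewrite /= /density -mulrDl -natrD; congr (_%:R / _).
    have -> : slice (A `|` B) S = (slice A S :|: slice B S)%SET.
      apply/setP => x; rewrite !inE; apply/asboolP/orP.
        by move=> [?|?]; [left|right]; apply/asboolP.
      by move=> [/asboolP ?|/asboolP ?]; [left|right].
    rewrite cardsU; suff -> : (slice A S :&: slice B S)%SET = finset.set0.
      by rewrite cards0 subn0.
    apply/setP => x; rewrite !inE; apply/negP => /andP[/asboolP a /asboolP b].
    suff : (A `&` B) (existT _ S x) by rewrite AB.
    by split.
  by apply: cvgD; exact: density_cvg.
Qed.

Lemma ultra_mean_inv : invariant_under family_act ultra_mean.
Proof.
move=> g A; rewrite /ultra_mean; congr (lim (_ @ U)); apply/funext => S.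
rewrite /density; congr (_%:R / _).
have -> : slice (family_act g @` A) S =
    [set (f S g * x)%g | x in slice A S]%SET.
  apply/setP => y; apply/idP/imsetP => [|[x + ->]]; rewrite inE => /asboolP.
    move=> [[T x] Ax]; rewrite /family_act/= => e.
    have TS : T = S by exact: (congr1 (@projT1 _ _) e).
    subst T; exists x; first by rewrite inE; apply/asboolP.
    by apply/esym; exact: existT_inj2 e.
  by move=> Ax; rewrite inE; apply/asboolP; exists (existT _ S x).
by rewrite card_imset//; exact: mulgI.
Qed.

(** Because [U] refines [totally], [U]-almost every [S] contains [g]; there [g] translates by a
    nontrivial element and fixes no point, so the density is 0. *)
Lemma ultra_mean_free g : g <> 1%g ->
  ultra_mean (fixed_points family_act g) = 0.
Proof.
move=> g1; apply: cvg_lim => //; apply: cvg_near_cst.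
apply: totallyU; exists [fset g]%fset => // S /fsubsetP gS.
rewrite /= /density; suff -> : slice (fixed_points family_act g) S = finset.set0.
  by rewrite cards0 mul0r.
apply/setP => x; rewrite !inE; apply/negP => /asboolP; rewrite /fixed_points/=.
rewrite /family_act/= => e.
have /eqP : (f S g * x)%g = x by exact: existT_inj2 e.
rewrite -[X in _ == X]mul1g (inj_eq (mulIg x)) => /eqP.
by apply: fP => //; apply: gS; rewrite inE.
Qed.

End UltraMean.

Lemma residually_finite_action (R : realType) (G : groupType) :
  residually_finite G -> exists (X : Type) (act : G -> X -> X),
    is_group_action act /\ essentially_free_amenable R act.
Proof.
move=> rfG.
have H (S : {fset G}) : exists (F : finGroupType) (f : {multiplicative G -> F}),
    forall g, g \in S -> g <> 1%g -> f g <> 1%g.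
  exact: residually_finite_seq.
pose F S := projT1 (cid (H S)).
pose f S : {multiplicative G -> F S} := projT1 (cid (projT2 (cid (H S)))).
have fP S g : g \in S -> g <> 1%g -> f S g <> 1%g.
  by rewrite /f /F; case: (cid (projT2 (cid (H S)))) => /= f' /(_ g).
have [U [UU tU]] := ultraFilterLemma (@totally_filter G).
exists {S : {fset G} & F S}, (@family_act G F f); split.
  exact: family_actP.
exists (@ultra_mean R G F U); split.
- exact: ultra_mean_fap.
- exact: ultra_mean_inv.
- by move=> g; exact: ultra_mean_free.
Qed.

Theorem proposition4p4 (R : realType) (G : groupType)
    (hT : kazhdan_property_T R G) :
  (exists (X : Type) (act : G -> X -> X),
     is_group_action act /\ essentially_free_amenable R act)
  <-> residually_finite G.
Proof.
split=> [[X [act [actP [mu [muP mu_inv mu_free]]]]] g g1|]; last first.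
  exact: residually_finite_action.
apply: contrapT => nsep.
pose D := [set x | infinite_set (range (act^~ x))].
(* A finite orbit moved by [g] would give a finite quotient detecting [g]. *)
have fix_g x : ~ D x -> fixed_points act g x.
  move=> /contrapT finO; apply: contrapT => gx; apply: nsep.
  exact: (@finite_orbit_separates G {classic X} act actP x).
have D_act h x : D x -> D (act h x).
  move=> Dx finO; apply: Dx; apply: sub_finite_set finO => _ [k _ <-].
  exists (k * h^-1)%g => //.
  by rewrite (group_actM actP) -(group_actM actP h^-1%g) mulVg (group_act1 actP).
(* The complement of [D] lies in the fixed points of [g], which are null by essential freeness. *)
have muD : mu D = 1.
  have mu_nD : mu (~` D) = 0.
    apply/eqP; rewrite eq_le (fap_ge0 muP) andbT -(mu_free g g1).
    by apply: (fap_le muP) => x; exact: fix_g.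
  have := fap_split muP D setT.
  by rewrite setIT setTD mu_nD addr0 (fap_setT muP).
(* The action and the mean are restricted to the points with infinite orbits, where Property (T)
   applies; [classic] supplies the choice structure that [l2] requires. *)
pose Y : choiceType := {classic {x | D x}}.
pose actY (h : G) (y : Y) : Y := exist _ (act h (sval y)) (D_act h _ (svalP y)).
have sval_inj (y z : Y) : sval y = sval z -> y = z.
  by case: y z => [y Dy] [z Dz] /= yz; subst z; congr exist; exact: Prop_irrelevance.
have actYP : is_group_action actY.
  by split=> [y|h k y]; apply: sval_inj; rewrite /= ?(group_act1 actP) ?(group_actM actP).
pose muY (A : set Y) := mu (sval @` A).
have muYP : is_finitely_additive_probability muY.
  split=> [A||A B AB]; first exact: (fap_ge0 muP).
    rewrite -muD; congr mu; apply/seteqP; split => [_ [y _ <-]|x Dx].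
      exact: (svalP y).
    by exists (exist _ x Dx).
  rewrite /muY image_setU; apply: (fap_setU muP).
  apply/seteqP; split => // _ [[y Ay <-] [z Bz /sval_inj yz]].
  have : (A `&` B) y by split => //; rewrite -yz.
  by rewrite AB.
have muY_inv : invariant_under actY muY.
  move=> h A; rewrite /muY -(mu_inv h (sval @` A)); congr mu.
  apply/seteqP; split => [_ [_ [y Ay <-] <-]|_ [_ [y Ay <-] <-]].
    by exists (sval y) => //; exists y.
  by exists (actY h y) => //; exists y.
have infY (y : Y) : infinite_set (range (actY^~ y)).
  move=> finO; apply: (svalP y); apply: sub_finite_set (finite_image sval finO).
  by move=> _ [h _ <-]; exists (actY h y) => //; exists h.
have [L [t [u [LV tL u0 uS]]]] := kazhdan_superharmonic actYP hT infY.
have := superharmonic_size_le muYP actYP muY_inv LV u0 uS.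
by rewrite leNgt tL.
Qed.
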